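(* For every homogeneous polynomial $F$ of degree $d$ over $\mathbb{C}$, \[ \operatorname{B}_{\mathrm{hom}}(F) \geq \sum_{j=1}^{d-1} \operatorname{str}_j(F). \]
   Context: A layered directed graph is a directed graph whose vertex set is partitioned into layers indexed by integers such that every edge goes between consecutive layers. A homogeneous algebraic branching program (ABP) in variables $x_1,\dots,x_n$ is a layered directed graph with one source and one sink whose edges are labeled by linear forms in $x_1,\dots,x_n$. The weight of a path is the product of its edge labels; the polynomial computed by the ABP is the sum of weights of all source-to-sink paths. Its size is the number of vertices other than the source and the sink. $\operatorname{B}_{\mathrm{hom}}(F)$ is the minimal size of a homogeneous ABP computing $F$. For $1\le j<d$, a $j$-restricted strength decomposition of $F$ is an expression $F=\sum_{k=1}^r G_k H_k$ with $G_k,H_k$ homogeneous, $\deg G_k=j$ and $\deg H_k = d-j$ (more generally degree less than $d$); $\operatorname{str}_j(F)$ is the minimal number $r$ of summands in such a decomposition. *)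

(* Defs.v *)
From HB Require Import structures.
From mathcomp Require Import all_boot all_order all_algebra.
(* [mpoly] has to be imported before the analysis files: in the other order
   their notation levels clash. *)
From mathcomp Require Import mpoly.
From mathcomp Require Import complex.
From mathcomp Require Import boolp classical_sets reals ereal.

Set Implicit Arguments.
Unset Strict Implicit.
Unset Printing Implicit Defensive.

Import Order.TTheory GRing.Theory Num.Theory.

Local Open Scope ring_scope.

(* The source (resp. sink) is the only vertex without incoming (resp. outgoing)
   edges.  [label u v] is only meaningful when [edge u v] holds. *)
Record homABP (K : comNzRingType) (n : nat) := HomABP {
  vertex : finType;
  edge : rel vertex;
  layer : vertex -> int;
  source : vertex;
  sink : vertex;
  label : vertex -> vertex -> {mpoly K[n]};
  edge_layer : forall u v, edge u v -> layer v = layer u + 1;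
  sourceP : forall v, (forall u, ~~ edge u v) <-> v = source;
  sinkP : forall u, (forall v, ~~ edge u v) <-> u = sink;
  label_linear : forall u v, edge u v -> label u v \is 1.-homog
}.

Arguments edge {K n} h.
Arguments layer {K n} h.
Arguments source {K n} h.
Arguments sink {K n} h.
Arguments label {K n} h.

(* A path from [u] is given by the sequence of its vertices after [u]. *)
Definition path_weight (K : comNzRingType) (n : nat) (A : homABP K n)
    (u : vertex A) (p : seq (vertex A)) : {mpoly K[n]} :=
  \prod_(l <- pairmap (label A) u p) l.

(* The bound on the length [k] excludes no path, see [size_path_lt_card]. *)
Definition abp_poly (K : comNzRingType) (n : nat) (A : homABP K n) :
    {mpoly K[n]} :=
  \sum_(k < #|vertex A|)
    \sum_(p : k.-tuple (vertex A) |
            path (edge A) (source A) p && (last (source A) p == sink A))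
      path_weight (source A) p.

Definition abp_size (K : comNzRingType) (n : nat) (A : homABP K n) : nat :=
  #|[pred v : vertex A | (v != source A) && (v != sink A)]|.

(* Minimum of a set of natural numbers, [+oo] if the set is empty; it is
   attained otherwise, see [nat_minP]. *)
Definition nat_min (R : realType) (P : set nat) : \bar R :=
  ereal_inf [set (m%:R : R)%:E | m in P]%classic.

Definition Bhom (R : realType) (n : nat) (F : {mpoly R[i][n]}) : \bar R :=
  nat_min R
    (fun s => exists A : homABP R[i] n, abp_poly A = F /\ abp_size A = s).

(* The zero polynomial is [e.-homog] for every [e]; allowing zero factors does
   not change the minimal number of summands. *)
Definition strength_decomp (K : comNzRingType) (n d j : nat)
    (F : {mpoly K[n]}) (r : nat) : Prop :=
  exists G H : 'I_r -> {mpoly K[n]},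
    [/\ forall k, G k \is j.-homog,
        forall k, H k \is (d - j)%N.-homog
      & F = \sum_(k < r) G k * H k].

Definition str (R : realType) (n d j : nat) (F : {mpoly R[i][n]}) : \bar R :=
  nat_min R (strength_decomp d j F).

Lemma size_path_lt_card (K : comNzRingType) (n : nat) (A : homABP K n)
    (u : vertex A) (p : seq (vertex A)) :
  path (edge A) u p -> (size p < #|vertex A|)%N.
Proof.
move=> pth; rewrite -[(size p).+1]/(size (u :: p)).
suff /card_uniqP <- : uniq (u :: p) by exact: max_card.
pose lt_layer := [rel x y : vertex A | layer A x < layer A y].
apply: (@sorted_uniq _ lt_layer).
- by move=> y x z /=; exact: lt_trans.
- by move=> x /=; rewrite ltxx.
- apply: (@sub_path _ (edge A)) pth => x y /edge_layer /= ->.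
  by rewrite ltrDl.
Qed.

Lemma nat_minP (R : realType) (P : set nat) :
  (exists m, P m) ->
  exists m, [/\ P m, forall k, P k -> (m <= k)%N
              & nat_min R P = (m%:R)%:E].
Proof.
case=> m0 Pm0.
have exP : exists m, `[< P m >] by exists m0; apply/asboolP.
case: (ex_minnP exP) => m /asboolP Pm minm; exists m; split=> //.
- by move=> k Pk; apply: minm; apply/asboolP.
- apply/eqP; rewrite eq_le; apply/andP; split.
    by apply: ereal_inf_lbound; exists m.
  apply: le_ereal_inf_tmp => _ [k Pk <-]; rewrite lee_fin ler_nat.
  by apply: minm; apply/asboolP.
Qed.

(* Main.v *)
(** Any source-to-sink path of a homogeneous ABP computing [F <> 0] has
    length [d], so it meets layer [j] in exactly one vertex [v].  Cutting all
    paths there writes [F] as the sum over the vertices [v] of layer [j] of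
    (paths from the source to [v]) * (paths from [v] to the sink), which is a
    [j]-restricted strength decomposition.  The layers strictly between the
    source and the sink are disjoint. *)
Require Import Defs.
From mathcomp Require Import all_boot all_order all_algebra.
From mathcomp Require Import mpoly.
From mathcomp Require Import complex.
From mathcomp Require Import classical_sets reals ereal.

Set Implicit Arguments.
Unset Strict Implicit.
Unset Printing Implicit Defensive.

Import Order.TTheory GRing.Theory Num.Theory.

Local Open Scope ring_scope.

Lemma big_tuple_cons (V : nmodType) (T : finType) (k : nat)
    (P : pred (seq T)) (F : seq T -> V) :
  \sum_(p : k.+1.-tuple T | P p) F p =
  \sum_(x : T) \sum_(p : k.-tuple T | P (x :: p)) F (x :: p).
Proof.
rewrite pair_big_dep /=.
rewrite (reindex (fun xp : T * k.-tuple T => [tuple of xp.1 :: xp.2])) //=.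
exists (fun p => (thead p, [tuple of behead p])) => [[x p] _|p _] /=.
  by congr pair; apply: val_inj.
by rewrite -tuple_eta.
Qed.

Section PathSums.

Variables (K : comNzRingType) (n : nat) (A : homABP K n).

Implicit Types (u v w : vertex A) (j k : nat).

(** The entry at [u], [v] of the [k]-th power of the weighted adjacency matrix, whose entries are
    the labels on edges and 0 elsewhere. *)
Fixpoint path_sum k u v : {mpoly K[n]} :=
  if k is k'.+1 then \sum_(w | edge A u w) label A u w * path_sum k' w v
  else (u == v)%:R.

Lemma sum_path_weight k u v :
  \sum_(p : k.-tuple (vertex A) | path (edge A) u p && (last u p == v))
    path_weight u p = path_sum k u v.
Proof.
elim: k u => [|k IHk] u.
  rewrite big_mkcond (big_pred1 [tuple]) /= => [|p]; last first.
    by rewrite [p]tuple0; apply/esym/eqP.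
  by case: eqP => _ //; rewrite /path_weight big_nil.
rewrite (big_tuple_cons k (fun p => path (edge A) u p && (last u p == v))) /=.
rewrite [RHS]big_mkcond; apply: eq_bigr => w _.
have [_|_] /= := boolP (edge A u w); last by rewrite big_pred0_eq.
rewrite -IHk mulr_sumr; apply: eq_bigr => p _.
by rewrite /path_weight /= big_cons.
Qed.

(** The product rule for matrix powers. It cuts each path at the vertex [w] reached after [j]
    steps. *)
Lemma path_sumD j k u v :
  path_sum (j + k) u v = \sum_w path_sum j u w * path_sum k w v.
Proof.
elim: j u => [|j IHj] u /=.
  rewrite (bigD1 u) //= eqxx mul1r big1 ?addr0 // => w /negPf.
  by rewrite eq_sym => ->; rewrite mul0r.
under eq_bigr do rewrite IHj mulr_sumr.
rewrite exchange_big /=; apply: eq_bigr => w _.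
by rewrite mulr_suml; apply: eq_bigr => x _; rewrite mulrA.
Qed.

Lemma path_sum_homog k u v : path_sum k u v \is k.-homog.
Proof.
elim: k u => [|k IHk] u /=.
  by case: eqP => _; rewrite ?dhomog0 ?dhomog1.
apply: rpred_sum => w uw; rewrite -add1n.
by apply: dhomogM; [apply: label_linear|].
Qed.

(** A nonzero sum has a nonzero summand, so some path of [k] edges exists, and each edge raises the
    layer by one. *)
Lemma path_sum_layer k u v :
  path_sum k u v != 0 -> layer A v = layer A u + k%:Z.
Proof.
elim: k u => [|k IHk] u /=.
  by case: (u =P v) => [->|_]; rewrite ?addr0 ?eqxx.
move=> nz0; have [w /andP [uw nz]] :
    exists w, edge A u w && (path_sum k w v != 0).
  apply/existsP; apply: contraNT nz0 => /existsPn H; apply/eqP.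
  apply: big1 => w uw; have := H w; rewrite uw negbK => /eqP ->.
  by rewrite mulr0.
by rewrite (IHk w nz) (edge_layer uw) -addrA -intS.
Qed.

(** The layers of source and sink determine the path length, so only one length [k] contributes. Its
    sum is homogeneous of degree [k], and a nonzero polynomial has only one degree, whence
    [k = d]. *)
Lemma homog_abp_poly d :
  abp_poly A \is d.-homog -> abp_poly A != 0 ->
  abp_poly A = path_sum d (source A) (sink A).
Proof.
have -> : abp_poly A =
    \sum_(k < #|vertex A|) path_sum k (source A) (sink A).
  by apply: eq_bigr => k _; rewrite sum_path_weight.
set S := \sum_(k < _) _ => homS nzS.
have [k nzk] :
    exists k : 'I_#|vertex A|, path_sum k (source A) (sink A) != 0.
  apply/existsP; apply: contraNT nzS => /existsPn H; apply/eqP.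
  by apply: big1 => k _; apply/eqP; rewrite -[_ == _]negbK H.
have ES : S = path_sum k (source A) (sink A).
  rewrite /S (bigD1 k) //= big1 ?addr0 // => i; apply: contraNeq => nzi.
  apply/eqP/val_inj; move: (path_sum_layer nzi).
  by rewrite (path_sum_layer nzk) => /addrI [] /esym.
rewrite [in LHS]ES; congr path_sum.
by apply: dhomog_uniq nzS _ homS; rewrite ES path_sum_homog.
Qed.

Definition layer_set j : pred (vertex A) :=
  [pred v | layer A v == layer A (source A) + j%:Z].

Lemma path_sum_strength_decomp d j : (j <= d)%N ->
  strength_decomp d j (path_sum d (source A) (sink A)) #|layer_set j|.
Proof.
move=> le_jd.
exists (fun k : 'I_#|layer_set j| => path_sum j (source A) (enum_val k)).
exists (fun k : 'I_#|layer_set j| => path_sum (d - j) (enum_val k) (sink A)).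
split=> [k|k|]; rewrite ?path_sum_homog // -{1}(subnKC le_jd) path_sumD.
rewrite -(big_enum_val (fun v =>
  path_sum j (source A) v * path_sum (d - j) v (sink A))).
rewrite [RHS]big_mkcond; apply: eq_bigr => v _; case: ifPn => // notv.
(* A vertex outside layer [j] is not reached in [j] steps, so its first factor vanishes. *)
have [->|/path_sum_layer lv] := eqVneq (path_sum j (source A) v) 0.
  by rewrite mul0r.
by rewrite inE lv eqxx in notv.
Qed.

Lemma sum_card_layer_set d :
  layer A (sink A) = layer A (source A) + d%:Z ->
  (\sum_(1 <= j < d) #|layer_set j| <= abp_size A)%N.
Proof.
move=> layer_sink.
(* The absolute value may also assign an index to vertices below the source; this can only enlarge
   the upper bound. *)
pose h v := `|layer A v - layer A (source A)|%N.
pose inner := [pred v : vertex A | (v != source A) && (v != sink A)].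
have -> : abp_size A = \sum_(v in inner) 1 by rewrite sum1_card.
(* Double counting: each inner vertex has a single index [h v], so it is counted at most once over
   all [j]. *)
apply: (@leq_trans (\sum_(v in inner) \sum_(1 <= j < d) (j == h v)));
  last first.
  apply: leq_sum => v _; rewrite -big_mkcond /= sum1_count.
  by rewrite (count_uniq_mem _ (iota_uniq _ _)) leq_b1.
rewrite exchange_big /= big_nat_cond [leqRHS]big_nat_cond.
apply: leq_sum => j /andP [/andP [j_gt0 j_ltd] _].
rewrite -sum1_card big_mkcond [leqRHS]big_mkcond /=.
apply: leq_sum => v _; case: ifP => //; rewrite inE => /eqP lv.
have -> : h v = j by rewrite /h lv addrC addKr.
(* The source has index 0 and the sink index [d], both outside the range of [j]. *)
rewrite eqxx ifT // inE /=; apply/andP; split.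
  apply: contraTneq j_gt0 => vs; move: lv; rewrite vs -[LHS]addr0.
  by move=> /addrI [<-].
apply: contraTneq j_ltd => vs; move: lv; rewrite vs layer_sink.
by move=> /addrI [->]; rewrite ltnn.
Qed.

End PathSums.

Lemma nat_min_le (R : realType) (P : set nat) (m : nat) :
  P m -> (nat_min R P <= (m%:R)%:E)%E.
Proof. by move=> Pm; apply: ereal_inf_lbound; exists m. Qed.

Theorem theorem12 (R : realType) (n d : nat) (F : {mpoly R[i][n]})
    (hF : F \is d.-homog) :
  (\sum_(1 <= j < d) str d j F <= Bhom F)%E.
Proof.
apply: le_ereal_inf_tmp => _ [_ [A [AF <-]] <-].
(* Any decomposition bounds [str] from above, so natural numbers [r j] with a bounded sum
   suffice. *)
suff [r [decr ler]] : exists r : nat -> nat,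
    (forall j, (j < d)%N -> strength_decomp d j F (r j)) /\
    (\sum_(1 <= j < d) r j <= abp_size A)%N.
  apply: (@le_trans _ _ (\sum_(1 <= j < d) ((r j)%:R : R)%:E)%E).
    rewrite big_nat_cond [leRHS]big_nat_cond; apply: lee_sum => j.
    by rewrite andbT => /andP [_ j_ltd]; apply/nat_min_le/decr.
  by rewrite sumEFin lee_fin -natr_sum ler_nat.
(* If [F = 0], the source and sink layers need not differ by [d]; empty decompositions replace the
   cuts. *)
have [F0|nzF] := eqVneq F 0.
  exists (fun=> 0%N); split=> [j _|]; last by rewrite big1.
  exists (fun=> 0), (fun=> 0); split=> [k|k|]; rewrite ?dhomog0 //.
  by rewrite big_ord0.
have EF : F = path_sum d (source A) (sink A).
  by rewrite -AF; apply: homog_abp_poly; rewrite AF.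
exists (fun j => #|@layer_set _ _ A j|); split=> [j /ltnW j_led|].
  by rewrite EF; apply: path_sum_strength_decomp.
by apply: sum_card_layer_set; apply: path_sum_layer; rewrite -EF.
Qed.
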